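(* Let $\vec G=(V,E)$ be a connected directed graph (which may or may not be a tree) with vertex set $V=\{1,\dots,n\}$ and edges $E=\{e_1,\dots,e_m\}$, and let $D\in\mathbb{R}^{m\times n}$ be its incidence matrix. Let $\{\bar S_j\}_{j\in[p]}$ be the family of all distinct sets of edge indices $\bar S_j\subset[m]$ such that $|\bar S_j|=m-n+2$ and $\operatorname{rank}(D_{-\bar S_j})=n-2$, so that the graph $(V,E\setminus E_{\bar S_j})$ has two connected components, $$(V,E\setminus E_{\bar S_j})=\big((V_1)_j,(E_1)_j\big)\cup\big((V_2)_j,(E_2)_j\big),\quad (V_1)_j\cap(V_2)_j=\emptyset,\quad (V_1)_j\cup(V_2)_j=V,$$ labelled such that $1\in(V_1)_j$. For $j\in[p]$ let $X_j=v_j/\|Dv_j\|_1$, where $v_j\in\mathbb{R}^n$ is given by $$(v_j)_i=\begin{cases}0,& i\in(V_1)_j,\\ 1,& i\in(V_2)_j,\end{cases}$$ and let $X\in\mathbb{R}^{n\times p}$ be the matrix with columns $X_j$, $j\in[p]$. Then for every $Y\in\mathbb{R}^n$ and every $\lambda>0$, $$\hat f_{\mathrm A}:=\arg\min_{f\in\mathbb{R}^n}\left\{\|Y-f\|_n^2+2\lambda\|Df\|_1\right\}=\begin{bmatrix}1_n&X\end{bmatrix}\arg\min_{\beta\in\mathbb{R}^{p+1}}\left\{\left\|Y-\begin{bmatrix}1_n&X\end{bmatrix}\beta\right\|_n^2+2\lambda\|\beta_{-1}\|_1\right\}.$$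
   Context: $[k]=\{1,\dots,k\}$. For $v\in\mathbb{R}^n$, $\|v\|_n^2=\|v\|_2^2/n$. $1_n$ is the vector of $n$ ones. $\beta_{-1}$ is the vector $\beta$ with its first entry removed. The right-hand side is understood as $\begin{bmatrix}1_n&X\end{bmatrix}\hat\beta$ for any minimizer $\hat\beta$. Each edge $e_i=(e_i^-,e_i^+)$ is directed from vertex $e_i^-$ to vertex $e_i^+\neq e_i^-$; the incidence matrix $D\in\{-1,0,1\}^{m\times n}$ has entries $D_{ij}=-1$ if $j=e_i^-$, $D_{ij}=+1$ if $j=e_i^+$, and $D_{ij}=0$ otherwise. For $S\subseteq[m]$, $E_S=\{e_i: i\in S\}$ and $D_{-S}$ is the submatrix of $D$ consisting of the rows with index in $[m]\setminus S$. Connectedness is understood disregarding edge directions; $n\ge2$. *)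

(* Defs.v *)
From HB Require Import structures.
From mathcomp Require Import all_boot all_order all_algebra.
From mathcomp Require Import classical_sets reals.

Set Implicit Arguments.
Unset Strict Implicit.
Unset Printing Implicit Defensive.

Import Order.TTheory GRing.Theory Num.Theory.
Local Open Scope ring_scope.

(* A directed graph on the vertices 'I_n is its family of edges e : 'I_m -> 'I_n * 'I_n,
   where (e i).1 is the tail e_i^- and (e i).2 is the head e_i^+. A subgraph on
   the same vertices is given by the set A of the indices of the edges kept. *)
Section Graph.
Variables (n m : nat) (e : 'I_m -> 'I_n * 'I_n).

Definition adjacent (A : {set 'I_m}) : rel 'I_n :=
  [rel x y | [exists i in A, (e i == (x, y)) || (e i == (y, x))]].

Definition connected_graph (A : {set 'I_m}) : Prop :=
  forall x y : 'I_n, connect (adjacent A) x y.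

Definition edges_within (A : {set 'I_m}) (W : {set 'I_n}) : {set 'I_m} :=
  [set i in A | ((e i).1 \in W) && ((e i).2 \in W)]%SET.

(* Each component is a pair (vertex set, set of edge indices). *)
Definition components (A : {set 'I_m}) : {set {set 'I_n} * {set 'I_m}} :=
  [set (W, edges_within A W) | W in
     equivalence_partition (connect (adjacent A)) [set: 'I_n]%SET]%SET.

Definition two_components (A : {set 'I_m}) (V1 : {set 'I_n}) (E1 : {set 'I_m})
    (V2 : {set 'I_n}) (E2 : {set 'I_m}) : Prop :=
  [/\ components A = [set (V1, E1); (V2, E2)]%SET,
      [disjoint V1 & V2], V1 :|: V2 = [set: 'I_n]%SET & E1 :|: E2 = A].

Variable R : realType.

Definition incidence : 'M[R]_(m, n) :=
  \matrix_(i, j) (if j == (e i).1 then -1 else if j == (e i).2 then 1 else 0).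

End Graph.

Arguments incidence {n m} e R.

Section Lasso.
Variable R : realType.

Definition remove_rows m n (D : 'M[R]_(m, n)) (S : {set 'I_m}) :
    'M[R]_(#|(~: S)%SET|, n) :=
  rowsub (fun i => enum_val i) D.

Definition l1norm n (v : 'cV[R]_n) : R := \sum_(i < n) `|v i 0|.

(* ||v||_n^2 = ||v||_2^2 / n *)
Definition sqnormn n (v : 'cV[R]_n) : R := (\sum_(i < n) v i 0 ^+ 2) / n%:R.

Definition argmin (T : Type) (F : T -> R) : set T :=
  [set x | forall y, F x <= F y]%classic.

Definition indicator n (W : {set 'I_n}) : 'cV[R]_n := \col_i (i \in W)%:R.

Definition dictionary m n p (D : 'M[R]_(m, n)) (V2 : 'I_p -> {set 'I_n}) :
    'M[R]_(n, p) :=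
  \matrix_(i, j) (indicator (V2 j) i 0 / l1norm (D *m indicator (V2 j))).

Definition with_intercept n p (X : 'M[R]_(n, p)) : 'M[R]_(n, 1 + p) :=
  row_mx (const_mx 1 : 'cV[R]_n) X.

Definition analysis_objective m n (D : 'M[R]_(m, n)) (Y : 'cV[R]_n) (lambda : R)
    (f : 'cV[R]_n) : R :=
  sqnormn (Y - f) + 2 * lambda * l1norm (D *m f).

(* dsubmx beta is beta without its first entry, the unpenalized intercept. *)
Definition synthesis_objective n p (X : 'M[R]_(n, p)) (Y : 'cV[R]_n) (lambda : R)
    (beta : 'cV[R]_(1 + p)) : R :=
  sqnormn (Y - with_intercept X *m beta) + 2 * lambda * l1norm (dsubmx beta).

End Lasso.

(* Main.v *)
Require Import Defs.
From HB Require Import structures.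
From mathcomp Require Import all_boot all_order all_algebra.
From mathcomp Require Import classical_sets reals.
From mathcomp Require Import boolp topology normedtype derive.
From mathcomp Require Import ring lra zify.

Set Implicit Arguments.
Unset Strict Implicit.
Unset Printing Implicit Defensive.

Import Order.TTheory GRing.Theory Num.Theory.
Import numFieldNormedType.Exports.
Local Open Scope ring_scope.

(** The synthesis problem is the analysis problem in other coordinates. Writing
    [1 X] for the dictionary with its intercept column, two facts suffice.

    - No coefficient vector is cheaper than the signal it produces: the l1 norm
      of D [1 X] beta is at most that of beta without its first entry, since D
      kills constants and every column of D X has l1 norm at most 1
      ([l1norm_dictionary_le]).
    - Every signal f equals [1 X] beta for a beta whose penalty is at most that
      of f ([represents], [elementary_represents]).

    Hence both problems have the same minimal value and [1 X] maps minimizers of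
    the second to minimizers of the first ([synthesis_argmin]). The analysis
    problem has exactly one minimizer: its objective is continuous, large
    outside a box ([analysis_argmin_exists]) and strictly convex
    ([analysis_argmin_unique]).

    The second fact is the substance. If some g has D g supported inside the
    support of D f without being proportional to D f, then after correcting g by
    a multiple of f one can move f along g and along -g without changing the
    penalty, until in each direction an entry of D f vanishes. So f is a convex
    combination of two signals of equal penalty and smaller support
    ([elementary_split_ind]), and it suffices to represent the elementary
    signals, for which no such g exists. For these, the rows of D on which D f
    vanishes have a kernel spanned by 1 and f, hence rank at least n - 2
    ([elementary_rank]); n - 2 independent ones among them are the complement of
    some set S j, and f is constant on each of its two components, that is, a
    constant plus a multiple of one atom. On a graph this replaces the
    decomposition of f into its level sets.

    That removing S j leaves two components is again a dimension count: one
    component would make the kernel a line, while the indicators of three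
    components would be independent elements of a kernel of dimension 2
    ([two_components_of_rank]). *)

(** * The l1 norm *)

Section L1norm.
Variables (R : realType) (n : nat).
Implicit Types u v : 'cV[R]_n.

Lemma l1norm_ge0 v : 0 <= l1norm v.
Proof. exact: sumr_ge0. Qed.

Lemma l1norm0 : l1norm (0 : 'cV[R]_n) = 0.
Proof. by rewrite /l1norm big1// => i _; rewrite mxE normr0. Qed.

Lemma l1norm_eq0 v : l1norm v = 0 -> v = 0.
Proof.
move=> /eqP; rewrite psumr_eq0// => /allP v0.
apply/colP => i; rewrite mxE.
by have /= := v0 i (mem_index_enum i); rewrite normr_eq0 => /eqP.
Qed.

Lemma ler_l1normD u v : l1norm (u + v) <= l1norm u + l1norm v.
Proof.
by rewrite -big_split/=; apply: ler_sum => i _; rewrite mxE ler_normD.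
Qed.

Lemma l1normZ a v : l1norm (a *: v) = `|a| * l1norm v.
Proof. by rewrite mulr_sumr; apply: eq_bigr => i _; rewrite mxE normrM. Qed.

Lemma l1norm_convex s u v : 0 <= s <= 1 ->
  l1norm (s *: u + (1 - s) *: v) <= s * l1norm u + (1 - s) * l1norm v.
Proof.
move=> /andP[s0 s1]; apply: le_trans (ler_l1normD _ _) _.
by rewrite !l1normZ !ger0_norm// subr_ge0.
Qed.

End L1norm.

Lemma ler_l1norm_mulmx (R : realType) m n (A : 'M[R]_(m, n)) (v : 'cV[R]_n) :
  (forall j, l1norm (col j A) <= 1) -> l1norm (A *m v) <= l1norm v.
Proof.
move=> A1; have -> : A *m v = \sum_j v j 0 *: col j A.
  apply/colP => i; rewrite mxE summxE.
  by apply: eq_bigr => j _; rewrite !mxE mulrC.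
apply: (@le_trans _ _ (\sum_j l1norm (v j 0 *: col j A))).
  apply: (big_ind2 (fun x y => l1norm x <= y)) => //.
  - by rewrite l1norm0.
  - by move=> x1 x2 y1 y2 h1 h2; apply: le_trans (ler_l1normD _ _) (lerD h1 h2).
by apply: ler_sum => j _; rewrite l1normZ ler_piMr.
Qed.

(** * Splitting a signal into signals of minimal support *)

(** The ratio test of linear programming: moving from [a] in the direction [b],
    stop at the first coordinate that reaches zero. *)
Lemma ratio_test (R : realType) (I : finType) (a b : I -> R) (i0 : I) :
  (forall i, 0 <= a i) -> (forall i, a i = 0 -> b i = 0) -> b i0 < 0 ->
  exists2 t, 0 < t & (forall i, 0 <= a i + t * b i) /\
    (exists2 i, a i != 0 & a i + t * b i = 0).
Proof.
move=> a0 ab bi0.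
have [i bi min_i] := @arg_minP _ _ _ i0 [pred i | b i < 0] (fun i => a i / - b i) bi0.
have {}bi : b i < 0 by [].
have ai : a i != 0 by apply: contraTneq bi => /ab ->; rewrite ltxx.
exists (a i / - b i).
  by rewrite divr_gt0 ?oppr_gt0// lt_neqAle eq_sym ai a0.
split; last by exists i => //; field; rewrite lt_eqF.
move=> k; have [bk|bk] := ltP (b k) 0; last first.
  by rewrite addr_ge0// mulr_ge0// divr_ge0// oppr_ge0 ltW.
have := min_i k bk; rewrite ler_pdivlMr ?oppr_gt0// mulrN; lra.
Qed.

Section Splitting.
Variable R : realType.

Definition vsupport m (u : 'cV[R]_m) : {set 'I_m} := [set i | u i 0 != 0]%SET.

(** As long as no entry of [u + t *: w] changes sign, its l1 norm is affine in [t]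
    with slope the sum in the last hypothesis. That sum being zero, the norm is
    constant up to the first sign change; it also forces some entry of [u] to
    shrink, so that a sign change does occur. *)
Lemma l1norm_shift m (u w : 'cV[R]_m) :
  (forall i, u i 0 = 0 -> w i 0 = 0) -> w != 0 ->
  \sum_i Num.sg (u i 0) * w i 0 = 0 ->
  exists2 t, 0 < t &
    l1norm (u + t *: w) = l1norm u /\ vsupport (u + t *: w) \proper vsupport u.
Proof.
move=> uw w0 bal; pose b i := Num.sg (u i 0) * w i 0.
have b_eq0 i : b i = 0 -> w i 0 = 0.
  by move=> /eqP; rewrite mulf_eq0 sgr_eq0 => /orP[] /eqP// /uw.
have [i0 bi0] : exists i, b i < 0.
  apply: contrapT => /forallNP nb; move/negP: w0; apply; apply/eqP/colP => i.
  rewrite mxE; apply: b_eq0; move/eqP: bal; rewrite psumr_eq0; last first.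
    by move=> k _; rewrite leNgt; apply/negP/nb.
  by move=> /allP/(_ i (mem_index_enum i)) /= /eqP.
have [||t t0 [ge0 [i1 ui1 eq0]]] := @ratio_test _ _ (fun i => `|u i 0|) b i0 _ _ bi0.
- by [].
- by move=> i /eqP; rewrite normr_eq0 /b => /eqP/uw ->; rewrite mulr0.
have shiftE i : `|u i 0| + t * b i = Num.sg (u i 0) * (u i 0 + t * w i 0).
  by rewrite mulrDr -normrEsg /b; ring.
have absE i : `|(u + t *: w) i 0| = `|u i 0| + t * b i.
  rewrite !mxE; have [ui|ui] := eqVneq (u i 0) 0.
    by rewrite /b ui uw// !mulr0 !addr0.
  have := ge0 i; rewrite shiftE => h; rewrite -[RHS](ger0_norm h).
  by rewrite normrM normr_sg ui mul1r.
exists t => //; split.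
  rewrite /l1norm; under eq_bigr do rewrite absE.
  by rewrite big_split/= -mulr_sumr bal mulr0 addr0.
apply/properP; split.
  apply/fintype.subsetP => i; rewrite !inE; apply: contraNneq => ui.
  by rewrite !mxE ui uw// mulr0 addr0.
exists i1; rewrite !inE; first by rewrite -normr_eq0.
by rewrite negbK -normr_eq0 absE eq0.
Qed.

(** Outside the kernel of [D], these signals span, modulo that kernel, the extreme
    rays of the epigraph of [f |-> l1norm (D *m f)]. *)
Definition elementary m n (D : 'M[R]_(m, n)) (f : 'cV[R]_n) : Prop :=
  forall g : 'cV[R]_n,
    (forall i, (D *m f) i 0 = 0 -> (D *m g) i 0 = 0) ->
    exists c, D *m g = c *: (D *m f).

(** Induction on the support of [D *m f]. A signal that is not elementary is a
    convex combination of two signals with smaller supports, on whose segment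
    the penalty is affine, so [P] need only be stable under such combinations. *)
Lemma elementary_split_ind m n (D : 'M[R]_(m, n)) (P : 'cV[R]_n -> Prop) :
  (forall f, elementary D f -> P f) ->
  (forall s f1 f2, 0 <= s <= 1 -> P f1 -> P f2 ->
     l1norm (D *m (s *: f1 + (1 - s) *: f2))
       = s * l1norm (D *m f1) + (1 - s) * l1norm (D *m f2) ->
     P (s *: f1 + (1 - s) *: f2)) ->
  forall f, P f.
Proof.
move=> Pelem Pmix f.
have [k] := ubnP #|vsupport (D *m f)|; elim: k f => // k IH f.
rewrite ltnS => suppk.
have [|nelem] := pselect (elementary D f); first exact: Pelem.
have [g gsupp gind] : exists2 g : 'cV[R]_n,
    (forall i, (D *m f) i 0 = 0 -> (D *m g) i 0 = 0) &
    forall c, D *m g <> c *: (D *m f).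
  apply: contrapT => ng; apply: nelem => g gs.
  by apply: contrapT => gc; apply: ng; exists g => // c h; apply: gc; exists c.
have Df0 : l1norm (D *m f) != 0.
  apply/eqP => /l1norm_eq0 Df0; apply: (gind 0); rewrite scale0r.
  by apply/colP => i; rewrite gsupp ?Df0 ?mxE.
set u := D *m f in suppk gsupp gind Df0.
set w := D *m g in gsupp gind.
pose bal (w : 'cV[R]_m) := \sum_i Num.sg (u i 0) * w i 0.
have balu : bal u = l1norm u by apply: eq_bigr => i _; rewrite -normrEsg.
(* [c] makes the corrected direction [g'] balanced, as moving without changing
   the penalty requires in both directions. *)
pose c := bal w / l1norm u.
pose g' := g - c *: f.
have coordE (a b : 'cV[R]_m) d i : (a - d *: b) i 0 = a i 0 - d * b i 0.
  by rewrite !mxE.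
have Dg'E : D *m g' = w - c *: u by rewrite mulmxBr -scalemxAr.
have g'supp i : u i 0 = 0 -> (D *m g') i 0 = 0.
  by move=> ui; rewrite Dg'E coordE ui gsupp// mulr0 subr0.
have Dg'0 : D *m g' != 0 by rewrite Dg'E subr_eq0; apply/eqP/gind.
have balg' : bal (D *m g') = 0.
  have -> : bal (D *m g') = bal w - c * bal u.
    rewrite /bal mulr_sumr -sumrB; apply: eq_bigr => i _.
    by rewrite Dg'E coordE; ring.
  by rewrite balu /c; field.
have [t1 t1_gt0 [n1 s1]] := l1norm_shift g'supp Dg'0 balg'.
have [|||t2 t2_gt0 [n2 s2]] := @l1norm_shift _ u (- (D *m g')).
- by move=> i ui; rewrite mxE g'supp// oppr0.
- by rewrite oppr_eq0.
- rewrite -[RHS]oppr0 -[in RHS]balg' -sumrN.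
  by apply: eq_bigr => i _; rewrite [X in _ * X]mxE mulrN.
have f1E : D *m (f + t1 *: g') = u + t1 *: (D *m g') by rewrite mulmxDr -scalemxAr.
have f2E : D *m (f - t2 *: g') = u + t2 *: (- (D *m g')).
  by rewrite mulmxBr -scalemxAr scalerN.
have t12 : t1 + t2 != 0 by rewrite lt0r_neq0// addr_gt0.
pose s := t2 / (t1 + t2).
have fE : f = s *: (f + t1 *: g') + (1 - s) *: (f - t2 *: g').
  by apply/colP => i; rewrite !mxE /s; field.
rewrite fE; apply: Pmix.
- apply/andP; split; first by rewrite divr_ge0 ?addr_ge0 ?ltW.
  by rewrite /s ler_pdivrMr ?addr_gt0// mul1r lerDr ltW.
- by apply: IH; rewrite f1E (leq_trans (proper_card s1)).
- by apply: IH; rewrite f2E (leq_trans (proper_card s2)).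
by rewrite -fE f1E f2E n1 n2 -/u; ring.
Qed.

End Splitting.

(** * Kernels and ranks *)

Lemma leq_rank_ker_spanned (F : fieldType) k n d (B : 'M[F]_(k, n)) (K : 'M[F]_(n, d)) :
  (forall g : 'cV[F]_n, B *m g = 0 -> exists c, g = K *m c) ->
  (n <= \rank B + d)%N.
Proof.
move=> kerK; have kerS : (kermx B^T <= K^T)%MS.
  apply/row_subP => i; have [c cE] : exists c, (row i (kermx B^T))^T = K *m c.
    apply: kerK; apply: trmx_inj.
    by rewrite trmx_mul trmxK -row_mul mulmx_ker row0 trmx0.
  by rewrite -[row _ _]trmxK cE trmx_mul submxMl.
have := leq_trans (mxrankS kerS) (rank_leq_row _).
by rewrite mxrank_ker mxrank_tr leq_subLR.
Qed.

Lemma rowsub1_free (F : fieldType) k n (g : 'I_k -> 'I_n) :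
  injective g -> row_free (rowsub g (1%:M : 'M[F]_n)).
Proof.
move=> g_inj; apply/row_freeP; exists (colsub g 1%:M).
by rewrite -mxsub_mul mulmx1; apply/matrixP => i j; rewrite !mxE inj_eq.
Qed.

Section RemoveRows.
Variable R : realType.

Lemma remove_rows_mul0 m n (D : 'M[R]_(m, n)) (A : {set 'I_m}) (g : 'cV[R]_n) :
  remove_rows D A *m g = 0 <-> forall i, i \notin A -> (D *m g) i 0 = 0.
Proof.
rewrite /remove_rows mul_rowsub_mx; split => [/colP D0 i iA|D0].
  have iA' : i \in (~: A)%SET by rewrite inE.
  by have := D0 (enum_rank_in iA' i); rewrite [LHS]mxE enum_rankK_in// [RHS]mxE.
apply/colP => k; rewrite [LHS]mxE [RHS]mxE D0//.
by have := enum_valP k; rewrite inE.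
Qed.

(** Rows of [remove_rows D A] can be discarded until exactly [k] independent ones
    are left; this yields a removed set of prescribed size. *)
Lemma exists_independent_rows m n (D : 'M[R]_(m, n)) (A : {set 'I_m}) k :
  (k <= \rank (remove_rows D A))%N ->
  exists B : {set 'I_m},
    [/\ A \subset B, #|(~: B)%SET| = k & \rank (remove_rows D B) = k].
Proof.
move=> k_le; pose g := widen_ord k_le.
have g_inj : injective g by move=> i j /(congr1 val) /= /val_inj.
pose mf := maxrankfun (remove_rows D A).
pose h i : 'I_m := enum_val (mf (g i)).
have h_inj : injective h.
  by move=> i j /enum_val_inj /maxrankfun_inj /g_inj.
pose Z := [set h i | i : 'I_k]%SET.
have cardZ : #|(~: ~: Z)%SET| = k by rewrite finset.setCK card_imset// card_ord.
exists (~: Z)%SET; split => //.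
  apply/fintype.subsetP => x xA; rewrite inE; apply/imsetP => -[i _ xE].
  by have := enum_valP (mf (g i)); rewrite -/(h i) -xE inE xA.
apply/eqP; rewrite eqn_leq; apply/andP; split.
  by rewrite -[leqRHS]cardZ rank_leq_row.
have <- : \rank (rowsub h D) = k.
  have -> : rowsub h D = rowsub g 1%:M *m rowsub mf (remove_rows D A).
    by rewrite mul_rowsub_mx mul1mx -!rowsub_comp.
  by rewrite mxrankMfree ?maxrowsub_free//; apply/eqP/rowsub1_free.
have hZ i : h i \in (~: ~: Z)%SET by rewrite finset.setCK; apply: imset_f.
apply: mxrankS; apply: (submx_rowsub (fun i => enum_rank_in (hZ i) (h i))) => i /=.
by rewrite enum_rankK_in.
Qed.

End RemoveRows.

(** * Incidence matrices and connected components *)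

Section Incidence.
Variables (R : realType) (n m : nat) (e : 'I_m -> 'I_n * 'I_n).
Hypothesis e_noloop : forall i, (e i).2 <> (e i).1.

Local Notation D := (incidence e R).

Lemma incidence_mulE (f : 'cV[R]_n) i :
  (D *m f) i 0 = f (e i).2 0 - f (e i).1 0.
Proof.
rewrite mxE (bigD1 (e i).1)//= (bigD1 (e i).2)/=; last exact/eqP.
rewrite big1 => [|j /andP[j1 j2]]; last first.
  by rewrite mxE (negbTE j1) (negbTE j2) mul0r.
have /eqP/negbTE n21 := @e_noloop i.
by rewrite !mxE eqxx n21 eqxx addr0 mul1r mulN1r addrC.
Qed.

Lemma incidence_mul_const (a : R) : D *m const_mx a = 0 :> 'cV_m.
Proof. by apply/colP => i; rewrite incidence_mulE !mxE subrr. Qed.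

Lemma connect_adjacent_sym (A : {set 'I_m}) : connect_sym (adjacent e A).
Proof.
apply: sym_connect_sym => x y.
by apply: eq_existsb => i; rewrite orbC.
Qed.

Lemma connect_edge (A : {set 'I_m}) i :
  i \in A -> connect (adjacent e A) (e i).1 (e i).2.
Proof.
move=> iA; apply: connect1; apply/existsP; exists i.
by rewrite iA -surjective_pairing eqxx.
Qed.

Lemma connect_incidence_ker (A : {set 'I_m}) (f : 'cV[R]_n) x y :
  (forall i, i \in A -> (D *m f) i 0 = 0) ->
  connect (adjacent e A) x y -> f x 0 = f y 0.
Proof.
move=> fA /connectP[s]; elim: s x => [|z s IH] x /=; first by move=> _ ->.
move=> /andP[/existsP[i /andP[iA xz]] zs ys]; rewrite -(IH z zs ys).
have := fA i iA; rewrite incidence_mulE => /eqP; rewrite subr_eq0.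
by case/orP: xz => /eqP -> /eqP.
Qed.

Lemma connected_ker (f : 'cV[R]_n) x :
  connected_graph e [set: 'I_m]%SET -> D *m f = 0 -> f = const_mx (f x 0).
Proof.
move=> conn Df0; apply/colP => y; rewrite mxE; apply/esym.
by apply: (@connect_incidence_ker [set: 'I_m]%SET) => // i _; rewrite Df0 mxE.
Qed.

(** The indicators of the components of the [v k] lie in the kernel, and restricting
    them to the [v k] gives the identity matrix, so they are independent. *)
Lemma leq_rank_disconnected (A : {set 'I_m}) d (v : 'I_d -> 'I_n) :
  (forall k l, connect (adjacent e (~: A)%SET) (v k) (v l) = (k == l)) ->
  (\rank (remove_rows D A) + d <= n)%N.
Proof.
set con := connect _ => vcon.
pose ind k : 'cV[R]_n := \col_x (con (v k) x)%:R.
pose K : 'M[R]_(n, d) := \matrix_(x, k) ind k x 0.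
have rankK : (d <= \rank K)%N.
  rewrite -{1}(mxrank1 R d); have <- : rowsub v 1%:M *m K = 1%:M.
    rewrite mul_rowsub_mx mul1mx; apply/matrixP => k l.
    by rewrite !mxE vcon eq_sym.
  exact: mxrankM_maxr.
apply: leq_trans (_ : \rank (remove_rows D A) + \rank K <= n)%N.
  by rewrite leq_add2l.
apply: mulmx0_rank_max; apply/matrixP => r k.
have : remove_rows D A *m ind k = 0.
  apply/remove_rows_mul0 => i iA; rewrite incidence_mulE !mxE.
  have/connect_edge ei : i \in (~: A)%SET by rewrite inE.
  by rewrite /con (same_connect_r (@connect_adjacent_sym _) ei) subrr.
move=> /colP/(_ r); rewrite [RHS]mxE => indr0; rewrite [RHS]mxE -[RHS]indr0.
by rewrite !mxE; apply: eq_bigr => x _; rewrite !mxE.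
Qed.

Lemma two_components_of_rank (A : {set 'I_m}) (x0 : 'I_n) :
  (1 < n)%N -> \rank (remove_rows D A) = (n - 2)%N ->
  exists V1 E1 V2 E2, two_components e (~: A)%SET V1 E1 V2 E2 /\ x0 \in V1.
Proof.
move=> n_gt1 rkA; pose con := connect (adjacent e (~: A)%SET).
have con_sym : symmetric con := @connect_adjacent_sym _.
have con_trans : transitive con := @connect_trans _ _.
have con_edge i : i \in (~: A)%SET -> con (e i).1 (e i).2 := @connect_edge _ i.
have [y0 x0y0] : exists y0, ~~ con x0 y0.
  apply/existsP; rewrite -negb_forall; apply/negP => /forallP conx0.
  have : (n <= \rank (remove_rows D A) + 1)%N.
    apply: (@leq_rank_ker_spanned _ _ _ _ _ (const_mx 1)) => g /remove_rows_mul0 gA.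
    exists (const_mx (g x0 0)); apply/colP => x.
    rewrite mxE big_ord1 !mxE mul1r; apply/esym.
    by apply: (@connect_incidence_ker (~: A)%SET) => // i; rewrite inE; apply: gA.
  by rewrite rkA; lia.
have cover z : con x0 z || con y0 z.
  apply: contraT; rewrite negb_or => /andP[x0z y0z].
  suff : (\rank (remove_rows D A) + 3 <= n)%N by rewrite rkA; lia.
  apply: (@leq_rank_disconnected _ _ (tnth [tuple x0; y0; z])) => k l.
  move: k l; do 2!case=> [[|[|[|//]]] ?]; rewrite !(tnth_nth x0)/= ?connect0//.
  - exact/negbTE.
  - exact/negbTE.
  - by rewrite -/con con_sym; exact/negbTE.
  - exact/negbTE.
  - by rewrite -/con con_sym; exact/negbTE.
  - by rewrite -/con con_sym; exact/negbTE.
pose V1 := [set y | con x0 y]%SET; pose V2 := [set y | con y0 y]%SET.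
have V12 x : x \in V1 -> x \in V2 -> False.
  rewrite !inE (con_sym y0) => h1 h2; move/negP: x0y0; apply.
  exact: con_trans h1 h2.
exists V1, (edges_within e (~: A)%SET V1), V2, (edges_within e (~: A)%SET V2).
split; last by rewrite inE /con connect0.
split.
- rewrite /components.
  suff -> : equivalence_partition con [set: 'I_n]%SET = [set V1; V2]%SET.
    by rewrite imsetU1 imset_set1.
  apply/setP => W; rewrite !inE; apply/imsetP/orP => [[x _ ->]|].
    have [x0x|y0x] := orP (cover x); [left|right]; apply/eqP/setP => y; rewrite !inE.
      exact/esym/(same_connect (@connect_adjacent_sym _)).
    exact/esym/(same_connect (@connect_adjacent_sym _)).
  by case=> /eqP ->; [exists x0|exists y0] => //; apply/setP => y; rewrite !inE.
- rewrite -finset.setI_eq0; apply/eqP/setP => x; rewrite finset.in_setI finset.in_set0.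
  by apply/negP => /andP[]; exact: V12.
- by apply/setP => x; rewrite !inE; exact: cover.
apply/setP => i; rewrite /edges_within !inE -andb_orr.
case iA : (i \notin A) => //=; rewrite -/con.
have ei : con (e i).1 (e i).2 by apply: con_edge; rewrite inE.
by have [h|h] := orP (cover (e i).1); rewrite h (con_trans _ _ _ h ei) ?orbT.
Qed.

(** The base vertices [x1] and [x2] serve to name the two values of a signal that
    is constant along the edges of [A]. *)
Lemma two_components_classes (A : {set 'I_m}) V1 E1 V2 E2 :
  two_components e A V1 E1 V2 E2 ->
  exists x1 x2, V1 = [set y | connect (adjacent e A) x1 y]%SET /\
                V2 = [set y | connect (adjacent e A) x2 y]%SET.
Proof.
case=> compE _ _ _.
have class W E : (W, E) \in components e A ->
    exists x, W = [set y | connect (adjacent e A) x y]%SET.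
  move=> /imsetP[_ /imsetP[x _ ->] [-> _]].
  by exists x; apply/setP => y; rewrite !inE.
have [|x1 V1E] := class V1 E1; first by rewrite compE !inE eqxx.
have [|x2 V2E] := class V2 E2; first by rewrite compE !inE eqxx orbT.
by exists x1, x2.
Qed.

(** If [D *m g] vanishes wherever [D *m f] does, then [D *m g = c *: D *m f], so
    [g - c *: f] is constant by connectedness: the rows on which [D *m f]
    vanishes have a kernel spanned by [1] and [f]. *)
Lemma elementary_rank (f : 'cV[R]_n) (x0 : 'I_n) :
  connected_graph e [set: 'I_m]%SET -> elementary D f ->
  (n - 2 <= \rank (remove_rows D (vsupport (D *m f))))%N.
Proof.
move=> conn felem; rewrite leq_subLR addnC.
apply: (@leq_rank_ker_spanned _ _ _ (1 + 1) _ (with_intercept f)).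
move=> g /remove_rows_mul0 gA.
have [i fi|c Dg] := felem g.
  by apply: gA; rewrite inE fi eqxx.
have gcf : D *m (g - c *: f) = 0 by rewrite mulmxBr -scalemxAr Dg subrr.
exists (col_mx (const_mx ((g - c *: f) x0 0)) (const_mx c)).
rewrite mul_row_col -[LHS](subrK (c *: f)) (connected_ker x0 conn gcf).
by congr (_ + _); apply/colP => i; rewrite [RHS]mxE big_ord1 !mxE ?mul1r// mulrC.
Qed.

End Incidence.

(** * The minimizer of the analysis estimator *)

Section Analysis.
Local Open Scope classical_set_scope.
Variable R : realType.

Lemma cvg_sumr (T I : Type) (F : set_system T) {FF : Filter F}
    (r : seq I) (f : I -> T -> R) (a : I -> R) : (forall i, f i x @[x --> F] --> a i) ->
  \sum_(i <- r) f i x @[x --> F] --> \sum_(i <- r) a i.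
Proof. by move=> fa; apply: cvg_big => //; exact: add_continuous. Qed.

Lemma continuous_l1norm_mul m n (D : 'M[R]_(m, n)) :
  continuous (fun u : 'rV[R]_n => l1norm (D *m u^T)).
Proof.
move=> x; apply: (cvg_sumr (F := nbhs x)) => i; apply: (cvg_norm (F := nbhs x)).
rewrite mxE; under [X in X @ _ --> _]eq_fun do rewrite mxE.
apply: (cvg_sumr (F := nbhs x)) => j; apply: (cvgMl_tmp (F := nbhs x)).
rewrite mxE; under [X in X @ _ --> _]eq_fun do rewrite mxE.
exact: coord_continuous.
Qed.

Lemma continuous_analysis_objective m n (D : 'M[R]_(m, n)) (Y : 'cV[R]_n)
    (lambda : R) :
  continuous (fun u : 'rV[R]_n => analysis_objective D Y lambda u^T).
Proof.
move=> x; apply: (cvgD (F := nbhs x)); last first.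
  apply: (cvgMl_tmp (F := nbhs x)). exact: (@continuous_l1norm_mul m n D x).
apply: (cvgMr_tmp (F := nbhs x)); apply: (cvg_sumr (F := nbhs x)) => i.
have cvgi : (fun u : 'rV[R]_n => (Y - u^T) i 0) @ x --> (Y - x^T) i 0.
  rewrite !mxE; under [X in X @ _ --> _]eq_fun do rewrite !mxE.
  by apply: (cvgB (F := nbhs x)); [exact: cvg_cst|exact: coord_continuous].
by under [X in X @ _ --> _]eq_fun do rewrite expr2; rewrite expr2;
   apply: (cvgM (F := nbhs x)).
Qed.

Lemma sqnormn_ge0 n (v : 'cV[R]_n) : 0 <= sqnormn v.
Proof. by rewrite divr_ge0// sumr_ge0// => i _; rewrite sqr_ge0. Qed.

(** With [F] the objective, outside the box of half-width [1 + n * F Y] around [Y]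
    the quadratic term alone exceeds [F Y]; so a minimum over this compact box
    is global. *)
Lemma analysis_argmin_exists m n (D : 'M[R]_(m, n)) (Y : 'cV[R]_n) (lambda : R) :
  (0 < n)%N -> 0 < lambda ->
  exists f, argmin (analysis_objective D Y lambda) f.
Proof.
move=> n_gt0 l_gt0; set F := analysis_objective D Y lambda.
have n_gt0R : 0 < n%:R :> R by rewrite ltr0n.
have pen_ge0 f : 0 <= 2 * lambda * l1norm (D *m f).
  by rewrite !mulr_ge0 ?l1norm_ge0// ltW.
have FY_ge0 : 0 <= F Y by rewrite addr_ge0 ?sqnormn_ge0.
pose M := 1 + n%:R * F Y.
have M_ge1 : 1 <= M by rewrite lerDl mulr_ge0.
pose box :=
  [set u : 'rV[R]_n | forall i, `[Y i 0 - M, Y i 0 + M]%classic (u ord0 i)]%classic.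
have [|||c _ cmin] := @compact_EVT_min _ R (fun u : 'rV[R]_n => F u^T) box.
- exists Y^T => i; rewrite /= in_itv/= mxE; lra.
- apply: (@rV_compact R n (fun i => `[Y i 0 - M, Y i 0 + M])) => i.
  exact: segment_compact.
- by apply: continuous_subspaceT; exact: continuous_analysis_objective.
have Y_box : Y^T \in box by rewrite inE => i; rewrite /= in_itv/= mxE; lra.
exists c^T => f; have [fbox|fbox] := pselect (box f^T).
  by rewrite -(trmxK f); apply: cmin; rewrite inE.
apply: le_trans (cmin _ Y_box) _; rewrite trmxK.
have [i fi] : exists i, M < `|(Y - f) i 0|.
  apply: contrapT => /forallNP h; apply: fbox => i.
  have /negP := h i; rewrite -leNgt ler_norml /= in_itv/= !mxE; lra.
apply: le_trans (_ : (Y - f) i 0 ^+ 2 / n%:R <= _); last first.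
  rewrite -[leLHS]addr0 lerD// ler_pM2r ?invr_gt0//.
  by rewrite (bigD1 i)//= lerDl sumr_ge0// => j _; rewrite sqr_ge0.
rewrite ler_pdivlMr// mulrC -[leRHS]real_normK ?num_real//.
(* [M <= M ^+ 2], because [M] is at least 1. *)
have h : n%:R * F Y <= M by rewrite /M; lra.
apply: le_trans h _; nra.
Qed.

(** At the midpoint of two minimizers the quadratic term would save a quarter of
    their squared distance, by the parallelogram identity. *)
Lemma analysis_argmin_unique m n (D : 'M[R]_(m, n)) (Y : 'cV[R]_n) (lambda : R)
    (f g : 'cV[R]_n) :
  (0 < n)%N -> 0 < lambda ->
  argmin (analysis_objective D Y lambda) f ->
  argmin (analysis_objective D Y lambda) g -> f = g.
Proof.
move=> n_gt0 l_gt0 minf ming.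
pose h := 2^-1 *: f + (1 - 2^-1) *: g.
have hf := minf h; have hg := ming h.
have half01 : 0 <= (2^-1 : R) <= 1 by lra.
have pen : l1norm (D *m h) <= 2^-1 * l1norm (D *m f) + (1 - 2^-1) * l1norm (D *m g).
  by rewrite mulmxDr -!scalemxAr l1norm_convex.
have quad : sqnormn (Y - h) =
    2^-1 * sqnormn (Y - f) + 2^-1 * sqnormn (Y - g) - 4^-1 * sqnormn (f - g).
  rewrite /sqnormn !mulrA -mulrDl -mulrBl; congr (_ / _).
  rewrite !mulr_sumr -big_split/= -sumrB; apply: eq_bigr => i _.
  by rewrite !mxE; field.
have sq0 : sqnormn (f - g) = 0.
  apply/eqP; rewrite eq_le sqnormn_ge0 andbT.
  move: hf hg; rewrite /analysis_objective quad.
  have := ler_wpM2l (ltW l_gt0) pen; lra.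
apply/eqP; rewrite -subr_eq0; apply/eqP/colP => i; rewrite [RHS]mxE.
move: sq0 => /eqP; rewrite mulf_eq0 invr_eq0 pnatr_eq0 (gtn_eqF n_gt0) orbF.
rewrite psumr_eq0; last by move=> j _; rewrite sqr_ge0.
by move=> /allP/(_ i (mem_index_enum i)); rewrite /= sqrf_eq0 => /eqP.
Qed.

End Analysis.

(** * Coefficients in the dictionary *)

Section Dictionary.
Variables (R : realType) (n m p : nat).

Definition represents (D : 'M[R]_(m, n)) (X : 'M[R]_(n, p)) (f : 'cV[R]_n) : Prop :=
  exists2 beta, f = with_intercept X *m beta &
    l1norm (dsubmx beta) <= l1norm (D *m f).

(** Mixing coefficient vectors costs at most the mixed penalties, and these add up
    exactly in the splitting of a signal. *)
Lemma represents_of_elementary (D : 'M[R]_(m, n)) (X : 'M[R]_(n, p)) :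
  (forall f, elementary D f -> represents D X f) -> forall f, represents D X f.
Proof.
move=> elem; apply: (elementary_split_ind elem).
move=> s f1 f2 s01 [b1 f1E n1] [b2 f2E n2] nE.
exists (s *: b1 + (1 - s) *: b2); first by rewrite mulmxDr -!scalemxAr -f1E -f2E.
rewrite nE linearD !linearZ/=; apply: le_trans (l1norm_convex _ _ s01) _.
by move/andP: s01 => [s0 s1]; rewrite lerD// ler_wpM2l// subr_ge0.
Qed.

Lemma l1norm_dictionary_le (D : 'M[R]_(m, n)) (V2 : 'I_p -> {set 'I_n})
    (beta : 'cV[R]_(1 + p)) :
  D *m const_mx 1 = 0 :> 'cV_m ->
  l1norm (D *m (with_intercept (dictionary D V2) *m beta)) <= l1norm (dsubmx beta).
Proof.
move=> D1; rewrite -[in leLHS](vsubmxK beta) mul_row_col.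
rewrite mulmxDr !mulmxA D1 mul0mx add0r.
apply: ler_l1norm_mulmx => j; rewrite colE -mulmxA -colE.
have -> : col j (dictionary D V2) =
    (l1norm (D *m indicator R (V2 j)))^-1 *: indicator R (V2 j).
  by apply/colP => i; rewrite !mxE mulrC.
rewrite -scalemxAr l1normZ ger0_norm ?invr_ge0 ?l1norm_ge0//.
(* A zero atom arises when its normalizing constant is zero, as [0^-1 = 0]. *)
have [->|nz] := eqVneq (l1norm (D *m indicator R (V2 j))) 0; first by rewrite mulr0.
by rewrite mulVf.
Qed.

Lemma represents_const (D : 'M[R]_(m, n)) (X : 'M[R]_(n, p)) a :
  represents D X (const_mx a).
Proof.
exists (col_mx (const_mx a) 0); last by rewrite col_mxKd l1norm0 l1norm_ge0.
rewrite mul_row_col mulmx0 addr0.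
by apply/colP => i; rewrite !mxE big_ord1 !mxE mul1r.
Qed.

Lemma represents_bipartition (D : 'M[R]_(m, n)) (V2 : 'I_p -> {set 'I_n}) j a b :
  D *m const_mx 1 = 0 :> 'cV_m -> D *m indicator R (V2 j) != 0 ->
  represents D (dictionary D V2) (const_mx a + b *: indicator R (V2 j)).
Proof.
move=> D1; set v := indicator R (V2 j) => Dv0; pose N := l1norm (D *m v).
have N0 : N != 0 by apply: contraNneq Dv0 => /l1norm_eq0/eqP.
have const1 : const_mx a = a *: const_mx 1 :> 'cV[R]_n.
  by apply/colP => i; rewrite !mxE mulr1.
exists (col_mx (const_mx a) ((b * N) *: delta_mx j 0)).
  rewrite mul_row_col; congr (_ + _).
    by apply/colP => i; rewrite !mxE big_ord1 !mxE mul1r.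
  rewrite -scalemxAr -colE; apply/colP => i; rewrite !mxE -/v -/N; field.
  exact: N0.
rewrite col_mxKd mulmxDr const1 -!scalemxAr D1 scaler0 add0r !l1normZ -/N.
have -> : l1norm (delta_mx j 0 : 'cV[R]_p) = 1.
  rewrite /l1norm (bigD1 j)//= !mxE !eqxx normr1 big1 ?addr0// => k kj.
  by rewrite !mxE (negbTE kj) normr0.
by rewrite mulr1 normrM (ger0_norm (l1norm_ge0 _)).
Qed.

End Dictionary.

(** * From analysis to synthesis *)

Section Transfer.
Variables (R : realType) (n m p : nat) (D : 'M[R]_(m, n)) (X : 'M[R]_(n, p)).

(** The two comparisons between penalties sandwich the synthesis problem: a
    representation of the analysis minimizer attains the common minimum, and any
    synthesis minimizer produces a signal attaining it, hence the same signal. *)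
Lemma synthesis_argmin (Y : 'cV[R]_n) (lambda : R) :
  (0 < n)%N -> 0 < lambda ->
  (forall beta, l1norm (D *m (with_intercept X *m beta)) <= l1norm (dsubmx beta)) ->
  (forall f, represents D X f) ->
  exists fhat : 'cV[R]_n,
    [/\ argmin (analysis_objective D Y lambda) = [set fhat]%classic,
        (argmin (synthesis_objective X Y lambda) !=set0)%classic &
        forall betahat, argmin (synthesis_objective X Y lambda) betahat ->
          fhat = with_intercept X *m betahat].
Proof.
move=> n0 l0 DX rep.
have le_synth beta : analysis_objective D Y lambda (with_intercept X *m beta) <=
    synthesis_objective X Y lambda beta.
  by rewrite lerD2l ler_wpM2l// mulr_ge0// ltW.
have [f minf] := analysis_argmin_exists D Y n0 l0.
have [b fE nb] := rep f.
have synth_b : synthesis_objective X Y lambda b <= analysis_objective D Y lambda f.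
  by rewrite /synthesis_objective -fE lerD2l ler_wpM2l// mulr_ge0// ltW.
exists f; split.
- apply/seteqP; split=> [g ming|_ ->//].
  exact: analysis_argmin_unique ming minf.
- by exists b => b'; apply: le_trans synth_b (le_trans (minf _) (le_synth b')).
move=> b' minb'; apply: (analysis_argmin_unique n0 l0 minf) => g.
by apply: le_trans (le_synth b') (le_trans (minb' b) (le_trans synth_b (minf g))).
Qed.

End Transfer.

(** * Elementary signals on a connected graph *)

Section Connected.
Variables (R : realType) (n m p : nat) (e : 'I_m -> 'I_n * 'I_n).
Hypothesis e_noloop : forall i, (e i).2 <> (e i).1.
Hypothesis e_connected : connected_graph e [set: 'I_m]%SET.
Local Notation D := (incidence e R).
Variables (S : 'I_p -> {set 'I_m}).
Hypothesis S_all : forall A : {set 'I_m},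
  #|A| = (m + 2 - n)%N -> \rank (remove_rows D A) = (n - 2)%N ->
  exists j, S j = A.
Variables (V1 V2 : 'I_p -> {set 'I_n}) (E1 E2 : 'I_p -> {set 'I_m}).
Hypothesis S_comp : forall j,
  two_components e (~: S j)%SET (V1 j) (E1 j) (V2 j) (E2 j).

(** The vanishing edge differences of [f] include those of a forest of [n - 2] edges
    with two components, which is the complement of some [S j]; being constant on
    both components, [f] is a constant plus a multiple of the indicator of [V2 j]. *)
Lemma elementary_represents (f : 'cV[R]_n) :
  (1 < n)%N -> elementary D f -> represents D (dictionary D V2) f.
Proof.
move=> n_gt1 felem; pose x0 := Ordinal (ltnW n_gt1).
have [Df0|Df0] := eqVneq (D *m f) 0.
  rewrite (connected_ker e_noloop x0 e_connected Df0).
  exact: represents_const.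
have [B [suppB cardB rkB]] :=
  exists_independent_rows (elementary_rank e_noloop x0 e_connected felem).
have [j SjB] : exists j, S j = B.
  apply: S_all rkB; have := cardsC B; rewrite cardB card_ord; lia.
have DfS i : i \in (~: S j)%SET -> (D *m f) i 0 = 0.
  rewrite SjB inE => iB; apply/eqP; apply: contraNT iB => fi.
  by apply: (fintype.subsetP suppB); rewrite inE.
have [x1 [x2 [V1E V2E]]] := two_components_classes (S_comp j).
have [_ _ V12 _] := S_comp j.
have fE : f = const_mx (f x1 0) + (f x2 0 - f x1 0) *: indicator R (V2 j).
  apply/colP => x; rewrite !mxE; have [xV2|xV2] := boolP (x \in V2 j).
    rewrite mulr1 addrC subrK; apply/esym/(connect_incidence_ker e_noloop DfS).
    by move: xV2; rewrite V2E inE.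
  rewrite mulr0 addr0; apply/esym/(connect_incidence_ker e_noloop DfS).
  have : x \in V1 j :|: V2 j by rewrite V12 inE.
  by rewrite inE (negbTE xV2) orbF V1E inE.
rewrite fE; apply: represents_bipartition; first exact: incidence_mul_const.
apply: contraNneq Df0 => v0.
by rewrite fE mulmxDr incidence_mul_const// -scalemxAr v0 scaler0 addr0.
Qed.

End Connected.
Theorem corollary5p4 (R : realType) (n m : nat) (n_ge2 : (1 < n)%N)
  (e : 'I_m -> 'I_n * 'I_n)
  (e_noloop : forall i, (e i).2 <> (e i).1)
  (e_connected : connected_graph e [set: 'I_m]%SET)
  (p : nat) (S : 'I_p -> {set 'I_m})
  (S_distinct : injective S)
  (S_all : forall A : {set 'I_m},
     (exists j, S j = A) <->
     (#|A| = (m + 2 - n)%N /\ \rank (remove_rows (incidence e R) A) = (n - 2)%N)) :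
  (forall j, exists V1 E1 V2 E2,
     two_components e (~: S j)%SET V1 E1 V2 E2 /\ Ordinal (ltnW n_ge2) \in V1) /\
  (forall (V1 V2 : 'I_p -> {set 'I_n}) (E1 E2 : 'I_p -> {set 'I_m}),
     (forall j, two_components e (~: S j)%SET (V1 j) (E1 j) (V2 j) (E2 j) /\
                Ordinal (ltnW n_ge2) \in V1 j) ->
     let D := incidence e R in
     let X := dictionary D V2 in
     forall (Y : 'cV[R]_n) (lambda : R), 0 < lambda ->
     exists fhat : 'cV[R]_n,
       [/\ argmin (analysis_objective D Y lambda) = [set fhat]%classic,
           (argmin (synthesis_objective X Y lambda) !=set0)%classic &
           forall betahat, argmin (synthesis_objective X Y lambda) betahat ->
             fhat = with_intercept X *m betahat]).
Proof.
split=> [j|V1 V2 E1 E2 comps D X Y lambda l_gt0].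
  have [_ rkS] : #|S j| = (m + 2 - n)%N /\
      \rank (remove_rows (incidence e R) (S j)) = (n - 2)%N.
    by apply/S_all; exists j.
  exact: (two_components_of_rank e_noloop (Ordinal (ltnW n_ge2)) n_ge2 rkS).
apply: synthesis_argmin => //.
- exact: ltnW.
- by move=> beta; apply: l1norm_dictionary_le; exact: incidence_mul_const.
apply: represents_of_elementary => f.
apply: (@elementary_represents _ _ _ _ _ e_noloop e_connected S _ V1 V2 E1 E2) => //.
- by move=> A cA rA; apply/S_all.
- by move=> j; case: (comps j).
Qed.
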